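(* Let $k\geq1$, $2k\leq n$, $(n,k)\neq(4,2)$, $G=\operatorname{Sym}(n)$ and $H=(\operatorname{Sym}(k)\times\operatorname{Sym}(n-k))\cap\operatorname{Alt}(n)$, where $\operatorname{Sym}(k)\times\operatorname{Sym}(n-k)$ is the setwise stabilizer of $\{1,\dots,k\}$. Let $\mathcal K^-(n,k)$ be the graph on $G/H$ in which $xH\sim yH$ iff $x(\{1,\dots,k\})\cap y(\{1,\dots,k\})=\varnothing$ and $\operatorname{sgn}(x)\neq\operatorname{sgn}(y)$. Then the least eigenvalue of $\mathcal K^-(n,k)$ is the eigenvalue afforded by the $[1^n]$-module.
   Context: $H$ is a multiplicity-free subgroup of $G$, and $\chi^{[1^n]}$ (the sign character) and $\chi^{[n-1,1]}$ are constituents of $1_H^G$. The adjacency matrix of $\mathcal K^-(n,k)$ commutes with the permutation action of $G$ on $\mathbb C^{G/H}$, which is a multiplicity-free sum of irreducibles, one isomorphic to the Specht module $S^\lambda$ for each constituent $\chi^\lambda$; the scalar by which the adjacency matrix acts on that summand is the eigenvalue afforded by the $\lambda$-module. *)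

(* Defs.v *)
From HB Require Import structures.
From mathcomp Require Import all_boot all_order all_algebra.
From mathcomp Require Import all_fingroup all_solvable all_character.

Set Implicit Arguments.
Unset Strict Implicit.
Unset Printing Implicit Defensive.

Import GroupScope GRing.Theory Num.Theory.
Local Open Scope ring_scope.

(* The ground set is 'I_n = {0, ..., n-1}, so {1, ..., k} becomes
   {0, ..., k-1}.  MathComp composes permutations from left to right,
   (s * t) i = t (s i), and lets groups act on the right.  The coset
   xH = {x o h | h in H} is therefore the right coset H :* x, the permutation
   action of G on G/H is right multiplication, and modules are spaces of row
   vectors. *)

Definition initial_set (n k : nat) : {set 'I_n} := [set i : 'I_n | (i < k)%N].

Definition kminus_stab (n k : nat) : {group {perm 'I_n}} :=
  'N_(Alt 'I_n)(initial_set n k | 'P)%G.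

Definition kminus_vertices (n k : nat) : {set {set {perm 'I_n}}} :=
  rcosets (kminus_stab n k) (Sym 'I_n).

(* The condition does not depend on the representatives: see kminus_adjE. *)
Definition kminus_adj (n k : nat) (X Y : {set {perm 'I_n}}) : bool :=
  [exists x in X, exists y in Y,
     [disjoint x @: initial_set n k & y @: initial_set n k]
       && (odd_perm x != odd_perm y)].

Definition kminus_adjmx (F : fieldType) (n k : nat) :
    'M[F]_#|kminus_vertices n k| :=
  \matrix_(i, j) (kminus_adj k (enum_val i) (enum_val j))%:R.

Lemma kminus_stabP n k (h : {perm 'I_n}) :
  h \in kminus_stab n k ->
  h @: initial_set n k = initial_set n k /\ odd_perm h = false.
Proof.
rewrite inE Alt_even => /andP[/negbTE -> hS]; split=> //.
by have := astabs_setact hS.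
Qed.

Lemma kminus_adjE n k (x y : {perm 'I_n}) :
  kminus_adj k (kminus_stab n k :* x) (kminus_stab n k :* y)
  = [disjoint x @: initial_set n k & y @: initial_set n k]
      && (odd_perm x != odd_perm y).
Proof.
have imM (h z : {perm 'I_n}) : h \in kminus_stab n k ->
    (h * z)%g @: initial_set n k = z @: initial_set n k.
  case/kminus_stabP=> hK _; rewrite -{2}hK -imset_comp.
  by apply: eq_imset => i; rewrite /= permM.
have oddM (h z : {perm 'I_n}) : h \in kminus_stab n k ->
    odd_perm (h * z)%g = odd_perm z.
  by case/kminus_stabP=> _ h0; rewrite odd_permM h0.
apply/idP/idP=> [/exists_inP[_ /rcosetP[h Hh ->]] | adj_xy].
  by case/exists_inP=> _ /rcosetP[h' Hh' ->]; rewrite !imM ?oddM.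
apply/exists_inP; exists x; first exact: rcoset_refl.
by apply/exists_inP; exists y; first exact: rcoset_refl.
Qed.

Definition kminus_mx (F : fieldType) (n k : nat) (g : {perm 'I_n}) :
    'M[F]_#|kminus_vertices n k| :=
  \matrix_(i, j) (enum_val i :* g == enum_val j)%:R.

Lemma kminus_mx_repr (F : fieldType) (n k : nat) :
  mx_repr (Sym 'I_n) (@kminus_mx F n k).
Proof.
split=> [|g h _ _]; apply/matrixP=> i j; rewrite !mxE.
  by rewrite rcoset1 (inj_eq enum_val_inj).
have Vig : enum_val i :* g \in kminus_vertices n k.
  have /rcosetsP[x _ ->] := enum_valP i.
  by rewrite -rcosetM; apply/rcosetsP; exists (x * g)%g; rewrite ?inE.
rewrite (bigD1 (enum_rank_in Vig (enum_val i :* g))) //= !mxE.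
rewrite enum_rankK_in // eqxx mul1r rcosetM big1 ?addr0 // => l neq_l.
rewrite !mxE (_ : (_ == enum_val l) = false) ?mul0r //.
apply: contraNF neq_l => /eqP E; apply/eqP/enum_val_inj.
  by rewrite enum_rankK_in.
Qed.

Definition kminus_repr (F : fieldType) (n k : nat) :
    mx_representation F (Sym 'I_n) #|kminus_vertices n k| :=
  MxRepresentation (@kminus_mx_repr F n k).

Lemma kminus_adjmxJ (F : fieldType) (n k : nat) (g : {perm 'I_n}) :
  kminus_adjmx F n k *m kminus_repr F n k g
  = kminus_repr F n k g *m kminus_adjmx F n k.
Proof.
have adjM X Y : X \in kminus_vertices n k -> Y \in kminus_vertices n k ->
    kminus_adj k (X :* g) (Y :* g) = kminus_adj k X Y.
  case/rcosetsP=> x _ ->; case/rcosetsP=> y _ ->.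
  rewrite -!rcosetM !kminus_adjE !odd_permM.
  have im z : (z * g)%g @: initial_set n k = g @: (z @: initial_set n k).
    by rewrite -imset_comp; apply: eq_imset => i; rewrite /= permM.
  rewrite !im -!setI_eq0 -imsetI; last by move=> ? ? _ _; apply: perm_inj.
  by rewrite imset_eq0; do 3!case: odd_perm.
have VM X h : X \in kminus_vertices n k -> X :* h \in kminus_vertices n k.
  case/rcosetsP=> x _ ->.
  by rewrite -rcosetM; apply/rcosetsP; exists (x * h)%g; rewrite ?inE.
apply/matrixP=> i j; rewrite !mxE.
have Vig := VM _ g (enum_valP i); have Vjg := VM _ g^-1%g (enum_valP j).
rewrite (bigD1 (enum_rank_in Vjg (enum_val j :* g^-1%g))) //= !mxE.
rewrite enum_rankK_in // rcosetKV eqxx mulr1 big1 ?addr0; last first.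
  move=> l neq_l; rewrite !mxE (_ : (_ == enum_val j) = false) ?mulr0 //.
  apply: contraNF neq_l => /eqP E; apply/eqP/enum_val_inj.
  by rewrite enum_rankK_in // -E rcosetK.
rewrite (bigD1 (enum_rank_in Vig (enum_val i :* g))) //= !mxE.
rewrite enum_rankK_in // eqxx mul1r big1 ?addr0; last first.
  move=> l neq_l; rewrite !mxE (_ : (_ == enum_val l) = false) ?mul0r //.
  apply: contraNF neq_l => /eqP E; apply/eqP/enum_val_inj.
  by rewrite enum_rankK_in.
by rewrite -[in RHS](rcosetKV g (enum_val j)) adjM // enum_valP.
Qed.

(* Specht modules.  The partition lambda of n is the sequence of its parts,
   and the tableau of shape lambda is filled row by row: the entry i sits in
   row reshape_index lambda i and column reshape_offset lambda i.  With
   R and C the row and column stabilizers of this tableau t, the Specht module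
   is the submodule of the group algebra generated by
     sum_(r in R, c in C) sgn(c) r c,
   the image of the polytabloid e_t = sum_(c in C) sgn(c) {t}c under the
   embedding of the tabloid module that sends {t} to sum_(r in R) r. *)

Definition row_stab (n : nat) (lambda : seq nat) : {set {perm 'I_n}} :=
  [set g : {perm 'I_n} |
     [forall i, reshape_index lambda (g i) == reshape_index lambda i]].

Definition col_stab (n : nat) (lambda : seq nat) : {set {perm 'I_n}} :=
  [set g : {perm 'I_n} |
     [forall i, reshape_offset lambda (g i) == reshape_offset lambda i]].

Definition polytabloid (F : fieldType) (n : nat) (lambda : seq nat) :
    'rV[F]_(gcard (Sym_group 'I_n)) :=
  let rho := regular_repr F (Sym_group 'I_n) in
  gring_row ((\sum_(r in row_stab n lambda) rho r)
             *m (\sum_(c in col_stab n lambda) (-1) ^+ odd_perm c *: rho c)).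

(* For lambda = [1^n] the group acts on the generator by the sign. *)
Lemma polytabloid_sign (F : fieldType) (n : nat) (g : {perm 'I_n}) :
  polytabloid F n (nseq n 1%N) *m regular_repr F (Sym_group 'I_n) g
  = (-1) ^+ odd_perm g *: polytabloid F n (nseq n 1%N).
Proof.
have idx m i : (i < m)%N -> reshape_index (nseq m 1%N) i = i.
  rewrite /reshape_index; elim: m i => [|m IHm] [|i] //= lt_im.
  by rewrite subn1 /= IHm.
have rowE : row_stab n (nseq n 1%N) = 1%g.
  apply/setP=> h; rewrite !inE; apply/forallP/eqP=> [fix_h | -> i].
    by apply/permP=> i; have /eqP := fix_h i; rewrite perm1 !idx // => /val_inj.
  by rewrite perm1.
have off (i : 'I_n) : reshape_offset (nseq n 1%N) i = 0%N.
  by rewrite /reshape_offset idx // take_nseq ?sumn_nseq ?mul1n ?subnn // ltnW.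
have colE : col_stab n (nseq n 1%N) = [set: {perm 'I_n}].
  by apply/setP=> h; rewrite !inE; apply/forallP=> i; rewrite !off.
rewrite /polytabloid -gring_row_mul rowE colE big_set1 repr_mx1 mul1mx -linearZ.
congr gring_row; rewrite mulmx_suml scaler_sumr.
rewrite [RHS](reindex_inj (mulIg g)) /=; apply: eq_big => [h | h _].
  by rewrite !inE.
rewrite -scalemxAl -repr_mxM ?inE // scalerA odd_permM signr_addb mulrC.
by rewrite -mulrA -signr_addb addbb mulr1.
Qed.

Definition specht_repr (F : fieldType) (n : nat) (lambda : seq nat) :=
  submod_repr (cyclic_mx_module (regular_repr F (Sym_group 'I_n))
                                (polytabloid F n lambda)).

(* The representation rG has exactly one submodule U isomorphic to rM, and A
   acts on U as the scalar theta. *)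
Definition affords_eigenvalue (F : fieldType) (gT : finGroupType)
    (G : {group gT}) (m d : nat) (rG : mx_representation F G m)
    (A : 'M[F]_m) (rM : mx_representation F G d) (theta : F) : Prop :=
  exists (U : 'M[F]_m) (modU : mxmodule rG U),
    [/\ mx_rsim (submod_repr modU) rM,
        forall (V : 'M[F]_m) (modV : mxmodule rG V),
          mx_rsim (submod_repr modV) rM -> (V :=: U)%MS
      & U *m A = theta *: U].

Definition least_eigenvalue (F : numFieldType) (m : nat) (A : 'M[F]_m)
    (theta : F) : Prop :=
  eigenvalue A theta /\ forall mu : F, eigenvalue A mu -> theta <= mu.

(* Main.v *)
Require Import Defs.
From mathcomp Require Import all_boot all_order all_algebra.
From mathcomp Require Import all_fingroup all_solvable all_character.
From mathcomp Require Import ring.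

Set Implicit Arguments.
Unset Strict Implicit.
Unset Printing Implicit Defensive.

Import GroupScope GRing.Theory Num.Theory.
Local Open Scope ring_scope.

(** Adjacent cosets have opposite signs, so on the row vector with entry sgn(x)
    at Hx the adjacency matrix acts as minus the degree.  This vector spans the
    only submodule on which G acts by the sign, because G is transitive on G/H.
    No eigenvalue of a d-regular graph is below -d: if v A = mu v, then
    the sum of A_ij |v_i + v_j|^2 over i, j equals 2 (d + mu) |v|^2. *)

Lemma regular_eigenvalue_ge (C : numClosedFieldType) m (A : 'M[C]_m)
    (d mu : C) :
    A^T = A -> (forall i j, 0 <= A i j) -> (forall j, \sum_i A i j = d) ->
  eigenvalue A mu -> - d <= mu.
Proof.
move=> symA A_ge0 sumA /eigenvalueP[v vA nz_v].
have Asym i j : A i j = A j i by rewrite -{1}symA mxE.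
pose N := \sum_j `|v 0 j| ^+ 2.
have N_gt0 : 0 < N.
  have [j nz_vj] := rV0Pn _ nz_v.
  rewrite /N (bigD1 j) //= ltr_pwDl ?exprn_gt0 ?normr_gt0 //.
  by apply: sumr_ge0 => i _; rewrite exprn_ge0.
have sum1 : \sum_i \sum_j A i j * `|v 0 j| ^+ 2 = d * N.
  rewrite exchange_big /= mulr_sumr; apply: eq_bigr => j _.
  by rewrite -mulr_suml sumA.
(* Column j of [v *m A = mu *: v], multiplied by the conjugate of v_j and summed over j. *)
have sum2 : \sum_i \sum_j A i j * (v 0 i * (v 0 j)^*) = mu * N.
  rewrite exchange_big /= mulr_sumr; apply: eq_bigr => j _.
  have /matrixP/(_ 0 j) := vA; rewrite !mxE => vAj.
  rewrite normCK mulrA -vAj mulr_suml.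
  by apply: eq_bigr => i _; rewrite mulrCA mulrA.
have flip (f : 'I_m -> 'I_m -> C) :
    \sum_i \sum_j A i j * f j i = \sum_i \sum_j A i j * f i j.
  rewrite exchange_big /=; apply: eq_bigr => i _.
  by apply: eq_bigr => j _; rewrite Asym.
have : 0 <= \sum_i \sum_j A i j * `|v 0 i + v 0 j| ^+ 2.
  by do 2!apply: sumr_ge0 => ? _; rewrite mulr_ge0 ?exprn_ge0.
have -> : \sum_i \sum_j A i j * `|v 0 i + v 0 j| ^+ 2 = (d + mu) * N *+ 2.
  (* The square expands into two diagonal and two cross terms; by symmetry of [A], swapping i and j
     pairs them off, whence the factor 2. *)
  transitivity (\sum_i \sum_j (A i j * `|v 0 j| ^+ 2 + A i j * `|v 0 i| ^+ 2
       + (A i j * (v 0 i * (v 0 j)^*) + A i j * (v 0 j * (v 0 i)^*)))).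
    apply: eq_bigr => i _; apply: eq_bigr => j _; rewrite -!mulrDr !normCK.
    by rewrite rmorphD /=; ring.
  under eq_bigr do rewrite !big_split /=.
  rewrite !big_split /= (flip (fun i j => `|v 0 j| ^+ 2)).
  by rewrite (flip (fun i j => v 0 i * (v 0 j)^*)) sum1 sum2 -!mulr2n -mulrnDl
             mulrDl.
by rewrite pmulrn_lge0 // pmulr_lge0 // -lerBlDl sub0r.
Qed.


Section LinearModules.

Variables (F : fieldType) (gT : finGroupType) (G : {group gT}) (chi : gT -> F).

(** If [v] is nonzero, this condition forces [chi] to be multiplicative on [G]. It is applied with
    [chi] the sign. *)
Definition semi_invariant m (rG : mx_representation F G m) (v : 'rV[F]_m) :=
  forall g, g \in G -> v *m rG g = chi g *: v.

Lemma semi_invariant_module m (rG : mx_representation F G m) (v : 'rV[F]_m) :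
  semi_invariant rG v -> mxmodule rG v.
Proof. by move=> vG; apply/mxmoduleP=> g Gg; rewrite vG // scalemx_sub. Qed.

Lemma cyclic_mx_semi_invariant m (rG : mx_representation F G m) (v : 'rV[F]_m) :
  semi_invariant rG v -> (cyclic_mx rG v :=: v)%MS.
Proof.
move=> /semi_invariant_module modv; apply/eqmxP.
by rewrite cyclic_mx_id cyclic_mx_sub.
Qed.

Lemma submod_repr_scalar m (rG : mx_representation F G m) (U : 'M[F]_m)
    (modU : mxmodule rG U) (v : 'rV[F]_m) g :
    (U <= v)%MS -> semi_invariant rG v -> g \in G ->
  submod_repr modU g = (chi g)%:M.
Proof.
move=> sUv vG Gg; apply: val_submod_inj.
rewrite -(mul1mx (submod_repr modU g)) val_submodJ //.
rewrite -[(chi g)%:M]scalemx1 linearZ /=.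
have /submxP[D ->] := submx_trans (val_submodP (1%:M : 'M_(\rank U))) sUv.
by rewrite -mulmxA vG // scalemxAr.
Qed.

Lemma rsim_semi_invariant m1 m2 (rG1 : mx_representation F G m1)
    (rG2 : mx_representation F G m2) (v1 : 'rV[F]_m1) (v2 : 'rV[F]_m2)
    (U1 : 'M[F]_m1) (U2 : 'M[F]_m2)
    (modU1 : mxmodule rG1 U1) (modU2 : mxmodule rG2 U2) :
    v1 != 0 -> v2 != 0 -> semi_invariant rG1 v1 -> semi_invariant rG2 v2 ->
    (U1 :=: v1)%MS -> (U2 :=: v2)%MS ->
  mx_rsim (submod_repr modU1) (submod_repr modU2).
Proof.
move=> nz1 nz2 vG1 vG2 defU1 defU2.
have r12 : \rank U1 = \rank U2 by rewrite defU1 defU2 !rank_rV nz1 nz2.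
(* Both actions are by the same scalar, so any invertible matrix intertwines them; [pid_mx] is the
   identity between two ranks that are equal but not convertible. *)
apply: (MxReprSim (B := pid_mx (\rank U1))) => // [|g Gg].
  by rewrite /row_free rank_pid_mx // r12.
rewrite (submod_repr_scalar _ _ vG1) ?defU1 //.
by rewrite (submod_repr_scalar _ _ vG2) ?defU2 // mul_scalar_mx mul_mx_scalar.
Qed.

(** A scalar action stays the same scalar under conjugation by an isomorphism. This confines every
    copy of the sign module to the semi-invariant rows. *)
Lemma rsim_row_semi_invariant m1 m2 (rG1 : mx_representation F G m1)
    (rG2 : mx_representation F G m2) (v2 : 'rV[F]_m2)
    (U1 : 'M[F]_m1) (U2 : 'M[F]_m2)
    (modU1 : mxmodule rG1 U1) (modU2 : mxmodule rG2 U2) (w : 'rV[F]_m1) :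
    semi_invariant rG2 v2 -> (U2 <= v2)%MS ->
    mx_rsim (submod_repr modU1) (submod_repr modU2) -> (w <= U1)%MS ->
  semi_invariant rG1 w.
Proof.
move=> vG2 sU2v2 /mx_rsim_def[B [B' B'B defU1]] sw g Gg.
rewrite -(in_submodK sw) -(val_submodJ modU1) // -linearZ /=; congr val_submod.
have -> : submod_mx modU1 g = B *m submod_repr modU2 g *m B' by exact: defU1.
rewrite (submod_repr_scalar _ sU2v2 vG2) // mul_mx_scalar -scalemxAl -scalemxAr.
(* The conjugation formula at the identity of [G]. *)
have -> : B *m B' = 1%:M; last by rewrite mulmx1.
by have := defU1 1%g (group1 G); rewrite !repr_mx1 mulmx1.
Qed.

End LinearModules.

(* The row and column stabilizers meet trivially, so the coefficient of the
   identity is 1. *)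
Lemma polytabloid_neq0 (F : fieldType) (n : nat) (lambda : seq nat) :
  polytabloid F n lambda != 0.
Proof.
have stab1 r c : r \in row_stab n lambda -> c \in col_stab n lambda ->
    (r * c == 1)%g = (r == 1%g) && (c == 1%g).
  rewrite !inE => /forallP Rr /forallP Cc.
  apply/eqP/andP=> [rc1 | [/eqP-> /eqP->]]; last by rewrite mulg1.
  suff r1 : r = 1%g by split; apply/eqP=> //; rewrite r1 mul1g in rc1.
  (* The entries i and r i share a row because of r, and a column because c sends r i back to i; row
     and column determine an entry. *)
  apply/permP=> i; rewrite perm1; apply: val_inj => /=.
  rewrite -(reshape_indexK lambda (r i)) (eqP (Rr i)).
  by rewrite -(eqP (Cc (r i))) -permM rc1 perm1 reshape_indexK.
(* [gring_row] reads off row [i1], so entry [i1] of the polytabloid is its coefficient at the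
   identity. *)
pose i1 := gring_index (Sym_group 'I_n) 1%g.
pose rho := regular_repr F (Sym_group 'I_n).
have entry r c : r \in row_stab n lambda -> c \in col_stab n lambda ->
    (rho r *m ((-1) ^+ odd_perm c *: rho c)) i1 i1
      = ((r == 1%g) && (c == 1%g))%:R.
  move=> Rr Cc; rewrite -scalemxAr -repr_mxM ?inE // !mxE eqxx /=.
  rewrite gring_indexK ?group1 // mul1g.
  rewrite (can_in_eq (@gring_indexK _ _)) ?inE // eq_sym stab1 //.
  case: (c =P 1%g) => [-> | _]; last by rewrite andbF mulr0.
  by rewrite odd_perm1 expr0 mul1r.
suff entry1 : polytabloid F n lambda 0 i1 = 1.
  by apply: contra_eq_neq entry1 => ->; rewrite mxE eq_sym oner_eq0.
rewrite /polytabloid -/rho /gring_row mxE mulmx_suml summxE.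
have R1 : 1%g \in row_stab n lambda.
  by rewrite inE; apply/forallP=> i; rewrite perm1.
have C1 : 1%g \in col_stab n lambda.
  by rewrite inE; apply/forallP=> i; rewrite perm1.
transitivity (\sum_(r in row_stab n lambda) \sum_(c in col_stab n lambda)
    ((r == 1%g) && (c == 1%g))%:R : F).
  apply: eq_bigr => r Rr; rewrite mulmx_sumr summxE.
  by apply: eq_bigr => c Cc; rewrite entry.
rewrite (bigD1 _ R1) (bigD1 _ C1) /= eqxx big1 => [|c /andP[_ /negbTE-> //]].
rewrite addr0 big1 ?addr0 // => r /andP[_ /negbTE->].
by rewrite big1.
Qed.

Section KminusSign.

Variables (n k : nat).
Local Notation H := (kminus_stab n k).
Local Notation V := (kminus_vertices n k).

Lemma kminus_vertex_ex x : exists i : 'I_#|V|, enum_val i = H :* x.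
Proof.
have Vx : H :* x \in V by apply/rcosetsP; exists x; rewrite ?inE.
by exists (enum_rank_in Vx (H :* x)); rewrite enum_rankK_in.
Qed.

Lemma kminus_vertexP (i : 'I_#|V|) : exists x, enum_val i = H :* x.
Proof. by have /rcosetsP[x _ ->] := enum_valP i; exists x. Qed.

Definition coset_sign (X : {set {perm 'I_n}}) : bool := odd_perm (repr X).

(** [H] consists of even permutations, so the choice made by [repr] does not matter. *)
Lemma coset_signE x : coset_sign (H :* x) = odd_perm x.
Proof.
rewrite /coset_sign.
have /rcosetP[h /kminus_stabP[_ h0] ->] := mem_repr_rcoset H x.
by rewrite odd_permM h0.
Qed.

Lemma kminus_adjC (X Y : {set {perm 'I_n}}) :
  kminus_adj k X Y = kminus_adj k Y X.
Proof.
by apply/exists_inP/exists_inP=> -[x Xx /exists_inP[y Yy]];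
  rewrite disjoint_sym eq_sym => adj; exists y => //;
  apply/exists_inP; exists x.
Qed.

Variable F : fieldType.
Local Notation rho := (kminus_repr F n k).
Local Notation sgn := (fun g : {perm 'I_n} => (-1) ^+ odd_perm g : F).

Lemma kminus_mul_entry (w : 'rV[F]_#|V|) (g : {perm 'I_n})
    (i j : 'I_#|V|) :
  enum_val i :* g = enum_val j -> (w *m rho g) 0 j = w 0 i.
Proof.
move=> ig_j; rewrite mxE (bigD1 i) //= mxE ig_j eqxx mulr1.
rewrite big1 ?addr0 // => l neq_li.
rewrite mxE -ig_j (can_eq (@rcosetK _ g)) (inj_eq enum_val_inj).
by rewrite (negbTE neq_li) mulr0.
Qed.

Definition sign_row : 'rV[F]_#|V| :=
  \row_j (-1) ^+ coset_sign (enum_val j).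

Lemma sign_row_neq0 : sign_row != 0.
Proof.
have [i _] := kminus_vertex_ex 1%g.
by apply/rV0Pn; exists i; rewrite mxE signr_eq0.
Qed.

Lemma sign_row_semi_invariant : semi_invariant sgn rho sign_row.
Proof.
move=> g _; apply/rowP=> j; have [x def_j] := kminus_vertexP j.
have [i def_i] := kminus_vertex_ex (x * g^-1)%g.
rewrite (@kminus_mul_entry _ g i) ?def_i ?def_j -?rcosetM ?mulgKV //.
rewrite !mxE def_i def_j !coset_signE odd_permM odd_permV.
by rewrite -signr_addb addbC.
Qed.

(** Right multiplication by x carries the base coset [H] to Hx, so the entry at Hx must be sgn(x)
    times the entry at [H]. *)
Lemma semi_invariant_sign_row (w : 'rV[F]_#|V|) :
  semi_invariant sgn rho w -> (w <= sign_row)%MS.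
Proof.
move=> wG; have [i def_i] := kminus_vertex_ex 1%g.
apply/sub_rVP; exists (w 0 i); apply/rowP=> j.
have [x def_j] := kminus_vertexP j.
have ix_j : enum_val i :* x = enum_val j by rewrite def_i def_j -rcosetM mul1g.
rewrite -[in RHS](kminus_mul_entry w ix_j) wG ?inE // !mxE def_j coset_signE.
by rewrite mulrAC -signr_addb addbb mul1r.
Qed.

(** [A] commutes with the action, so it sends the sign row to a semi-invariant row, hence to a
    multiple of itself. The same theta is then computed entrywise. *)
Lemma sign_row_eigen : exists theta : F,
  sign_row *m kminus_adjmx F n k = theta *: sign_row
  /\ forall j, \sum_i kminus_adjmx F n k i j = - theta.
Proof.
have /semi_invariant_sign_row/sub_rVP[theta uA] :
    semi_invariant sgn rho (sign_row *m kminus_adjmx F n k).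
  move=> g Gg; rewrite -mulmxA kminus_adjmxJ mulmxA.
  by rewrite sign_row_semi_invariant // scalemxAl.
exists theta; split=> // j; have /rowP/(_ j) := uA; rewrite !mxE => uAj.
apply: (mulfI (negbT (signr_eq0 F (coset_sign (enum_val j))))).
rewrite mulrN [in RHS]mulrC -uAj mulr_sumr -sumrN; apply: eq_bigr => i _.
have [[x def_i] [y def_j]] := (kminus_vertexP i, kminus_vertexP j).
rewrite !mxE def_i def_j kminus_adjE !coset_signE.
(* Equal signs make the adjacency entry 0; opposite signs have product -1. *)
case: (odd_perm x) (odd_perm y) => [] [];
  by rewrite ?andbF ?mulr0 ?oppr0 ?expr0 ?expr1 ?mulN1r ?mul1r ?opprK.
Qed.

End KminusSign.

Theorem theorem8p4 (C : numClosedFieldType) (n k : nat)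
    (k_ge1 : (1 <= k)%N) (le_2k_n : (2 * k <= n)%N)
    (nk_neq : (n, k) <> (4, 2)) :
  exists theta : C,
    least_eigenvalue (kminus_adjmx C n k) theta
    /\ affords_eigenvalue (kminus_repr C n k) (kminus_adjmx C n k)
         (specht_repr C n (nseq n 1%N)) theta.
Proof.
have [theta [uA degA]] := sign_row_eigen n k C.
have nz_u := sign_row_neq0 n k C; have uG := @sign_row_semi_invariant n k C.
have pG : semi_invariant (fun g => (-1) ^+ odd_perm g)
    (regular_repr C (Sym_group 'I_n)) (polytabloid C n (nseq n 1%N)).
  by move=> g _; apply: polytabloid_sign.
have nz_p : polytabloid C n (nseq n 1%N) != 0.
  by apply: polytabloid_neq0.
exists theta; split; first split.
- by apply/eigenvalueP; exists (sign_row n k C).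
(* The degree is [- theta], so the general lower bound is theta itself. *)
- move=> mu; rewrite -[theta]opprK; apply: regular_eigenvalue_ge => //.
    by apply/matrixP=> i j; rewrite !mxE kminus_adjC.
  by move=> i j; rewrite mxE ler0n.
exists (cyclic_mx (kminus_repr C n k) (sign_row n k C)).
exists (cyclic_mx_module _ _).
have defU := cyclic_mx_semi_invariant uG.
have defP := cyclic_mx_semi_invariant pG.
have simU := rsim_semi_invariant (cyclic_mx_module _ _) (cyclic_mx_module _ _)
  nz_u nz_p uG pG defU defP.
split=> [|V modV simV|]; first exact: simU.
(* Uniqueness: [V] has the rank of the sign line, both being isomorphic to the Specht module, and
   all its rows are semi-invariant, so they lie on that line. *)
- apply/eqmxP; rewrite -(geq_leqif (mxrank_leqif_eq _)).
    by rewrite (mxrank_rsim simU) (mxrank_rsim simV).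
  apply/row_subP=> i; rewrite defU; apply: semi_invariant_sign_row.
  apply: (rsim_row_semi_invariant pG _ simV) (row_sub i V).
  by rewrite defP.
have /submxP[D ->] : (cyclic_mx (kminus_repr C n k) (sign_row n k C)
                       <= sign_row n k C)%MS by rewrite defU.
by rewrite -mulmxA uA scalemxAr.
Qed.
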